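(* Let $(S,\Sigma,\lambda)$ and $(Y,\mu)$ be $\sigma$-finite measure spaces, suppose $B:Y\to\Sigma$ is a core map, and let $b=(\lambda\circ B)^*$, the non-increasing rearrangement with respect to $\mu$ of the function $y\mapsto\lambda(B(y))$. If $b(t)\to0$ as $t\to\infty$, then there exists a positive, admissible map $\Phi:L^1+L^\infty\to L^1_\mu+L^\infty_\mu$ of norm at most one such that $J_B=\Phi H_b$ on $L^1+L^\infty$.
   Context: $L^p_\mu$ denotes the usual Lebesgue space of complex-valued functions for the measure $\mu$; $L^p$ (no subscript) is the Lebesgue space for Lebesgue measure on $(0,\infty)$. Core map: a map $B:Y\to\Sigma$ such that (I) the range of $B$ is a totally ordered (by inclusion) subset of $\Sigma$; (II) for each $E\in\Sigma$, $y\mapsto\lambda(E\cap B(y))$ is $\mu$-measurable; (III) $\bigcup_{y\in Y}B(y)=\bigcup_{y\in Y_0}B(y)$ for some countable $Y_0\subseteq Y$; (IV) $\lambda(B(y))<\infty$ for all $y\in Y$. Operators: $J_Bf(y)=\int_0^{\lambda(B(y))}f(t)\,dt$ for $y\in Y$, and $H_bf(x)=\int_0^{b(x)}f(t)\,dt$ for $x>0$. Rearrangement: for a $\mu$-measurable $f$ on $Y$, $\mu_f(t)=\mu\{y\in Y:|f(y)|>t\}$ for $t>0$, and $f^*(x)=\sup\{t>0:x<\mu_f(t)\}$ for $x>0$, with $\sup\emptyset=0$. Admissible map: for $\sigma$-finite measures $\alpha,\beta$, a linear map $T:L^1_\alpha+L^\infty_\alpha\to L^1_\beta+L^\infty_\beta$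 is admissible if its restrictions $L^1_\alpha\to L^1_\beta$ and $L^\infty_\alpha\to L^\infty_\beta$ are bounded; its norm is the larger of the norms of these two restrictions. It is positive if it maps non-negative functions to non-negative functions. *)

(* Defs.v *)
From HB Require Import structures.
From mathcomp Require Import all_boot all_order all_algebra.
From mathcomp Require Import complex.
From mathcomp Require Import all_classical all_reals all_analysis.
From mathcomp Require Import measurable_realfun.

Set Implicit Arguments.
Unset Strict Implicit.
Unset Printing Implicit Defensive.

Import Order.TTheory GRing.Theory Num.Theory.
Import numFieldNormedType.Exports.

Local Open Scope classical_set_scope.
Local Open Scope ring_scope.
Local Open Scope complex_scope.

Section ComplexLp.
Context {R : realType} {d : measure_display} {X : measurableType d}.
Variable mu : {measure set X -> \bar R}.

(* R[i] carries no sigma-algebra in the libraries: measurability is taken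
   componentwise. *)
Definition cmeasurable (f : X -> R[i]) : Prop :=
  measurable_fun setT (fun x => complex.Re (f x)) /\
  measurable_fun setT (fun x => complex.Im (f x)).

Definition cLnorm (p : \bar R) (f : X -> R[i]) : \bar R :=
  Lnorm mu p (fun x => (Normc.normc (f x))%:E).

(* Elements of L^p are represented by functions; identification of functions
   equal almost everywhere is handled by the operators below. *)
Definition cLp (p : \bar R) (f : X -> R[i]) : Prop :=
  cmeasurable f /\ (cLnorm p f < +oo)%E.

Definition cL1Loo (f : X -> R[i]) : Prop :=
  exists g h : X -> R[i],
    [/\ cLp 1%E g, cLp +oo%E h & f = (fun x => g x + h x)].

(* Adjoining 0 encodes the convention sup(emptyset) = 0. *)
Definition rearrangement (f : X -> \bar R) (x : R) : \bar R :=
  ereal_sup ([set 0%E] `|`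
    [set t%:E | t in [set t : R |
       0 < t /\ (x%:E < mu [set y | t%:E < `|f y|])%E]]).

End ComplexLp.

Section Admissible.
Context {R : realType} {d d' : measure_display}.
Context {X : measurableType d} {Z : measurableType d'}.
Variables (alpha : {measure set X -> \bar R}) (beta : {measure set Z -> \bar R}).
Variable T : (X -> R[i]) -> (Z -> R[i]).

(* T induces a linear map L^1 + L^oo -> L^1 + L^oo on classes modulo almost
   everywhere equality. *)
Definition linear_L1Loo : Prop :=
  [/\ forall f, cL1Loo alpha f -> cL1Loo beta (T f),
      forall f g, cL1Loo alpha f -> cL1Loo alpha g ->
        f = g %[ae alpha] -> T f = T g %[ae beta]
    & forall (c : R[i]) f g, cL1Loo alpha f -> cL1Loo alpha g ->
        T (fun x => c * f x + g x) = (fun z => c * T f z + T g z) %[ae beta]].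

Definition bounded_on_Lp (p : \bar R) : Prop :=
  exists M : R, forall f, cLp alpha p f ->
    cLp beta p (T f) /\ (cLnorm beta p (T f) <= M%:E * cLnorm alpha p f)%E.

Definition opnorm_Lp (p : \bar R) : \bar R :=
  ereal_sup [set cLnorm beta p (T f) |
    f in [set f | cLp alpha p f /\ (cLnorm alpha p f <= 1)%E]].

Definition admissible : Prop :=
  [/\ linear_L1Loo, bounded_on_Lp 1%E & bounded_on_Lp +oo%E].

Definition admissible_norm : \bar R :=
  Order.max (opnorm_Lp 1%E) (opnorm_Lp +oo%E).

(* In R[i], 0 <= z means that z is real and nonnegative. *)
Definition positive_map : Prop :=
  forall f, cL1Loo alpha f ->
    (\forall x \ae alpha, 0 <= f x) -> \forall z \ae beta, 0 <= T f z.

End Admissible.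

Section HardyOperators.
Context {R : realType}.

(* Lebesgue measure on (0,oo), as a measure on R vanishing on (-oo,0]. *)
Definition lebesgue_pos : {measure set (measurableTypeR R) -> \bar R} :=
  mrestr (@lebesgue_measure R) (measurable_itv `]0%R, +oo[).

Definition cintegral0 (c : \bar R) (f : R -> R[i]) : R[i] :=
  let D := [set t : R | 0 < t /\ (t%:E < c)%E] in
  Rintegral (@lebesgue_measure R) D (fun t => complex.Re (f t)) +i*
  Rintegral (@lebesgue_measure R) D (fun t => complex.Im (f t)).

Definition hardy_b (b : R -> \bar R) (f : R -> R[i]) (x : R) : R[i] :=
  cintegral0 (b x) f.

Context {dS dY : measure_display}.
Context {S : measurableType dS} {Y : measurableType dY}.
Variables (lambda : {measure set S -> \bar R}) (B : Y -> set S).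

Definition core_map : Prop :=
  (forall y, measurable (B y)) /\
  [/\ forall y z, B y `<=` B z \/ B z `<=` B y,
      forall E, measurable E ->
        measurable_fun setT (fun y => lambda (E `&` B y)),
      exists2 Y0 : set Y, countable Y0 &
        \bigcup_(y in setT) B y = \bigcup_(y in Y0) B y
    & forall y, (lambda (B y) < +oo)%E].

Definition hardy_core (f : R -> R[i]) (y : Y) : R[i] :=
  cintegral0 (lambda (B y)) f.

End HardyOperators.

(* Main.v *)
Require Import Defs.
From HB Require Import structures.
From mathcomp Require Import all_boot all_order all_algebra.
From mathcomp Require Import complex.
From mathcomp Require Import all_classical all_reals all_analysis.
From mathcomp Require Import measurable_realfun.
From mathcomp Require Import ess_sup_inf ring lra.

Set Implicit Arguments.
Unset Strict Implicit.
Unset Printing Implicit Defensive.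

Import Order.TTheory GRing.Theory Num.Theory.
Import numFieldNormedType.Exports.

Local Open Scope classical_set_scope.
Local Open Scope ring_scope.

(* Write r y = lambda (B y), m s = mu {r > s} and a s = mu {r = s}.  The rank
   sigma (y, u) = m (r y) + u * a (r y), for r y > 0 and 0 <= u < 1, orders Y by
   decreasing values of r and spreads the atoms of r over intervals.  Its law
   under mu x Lebesgue is dominated by Lebesgue measure on (0, oo), and
   b (sigma (y, u)) = r y for almost every y and every u.  Hence
   Phi f y = int_0^1 f (sigma (y, u)) du, set to 0 where r y = 0, is a positive
   contraction on L^1 and L^oo, and it sends H_b f = F o b to F o r = J_B f,
   where F is the primitive of f. *)

(** * Averaging along a map with dominated law *)

(** The coordinate [u] is forced by the level sets of [r] of positive measure: such a set must fill
    a whole interval of ranks, yet it may be an atom of [mu] that no map defined on [Y] alone can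
    spread out. Averaging over [u] loses nothing, because [b], and hence [H_b f], is constant on
    that interval. The hypothesis [b t --> 0] enters as finiteness of [m s] for [s > 0]: it makes
    the ranks real numbers and gives continuity of [mu] from above. Domination of the law rests on
    an exact count: ranks at most [x] have mass exactly [x] when [0 < x < m 0]. Subtracting two such
    masses bounds the law on intervals, and covers by intervals extend the bound to measurable sets.
    Domination is enough: it controls [L^1] norms and makes preimages of null sets null, while the
    [L^oo] bound uses only that [u] ranges over a set of length at most one. The identity
    [b (m s) = s] fails when [m] is constant just to the left of [s] and [s] carries no atom. Each
    such flat piece contains a rational, so countably many null sets cover the exceptional
    points. *)

Section ComplexModulus.
Context {R : realType}.
Implicit Types z : R[i].

Lemma normcE z :
  Normc.normc z = Num.sqrt (complex.Re z ^+ 2 + complex.Im z ^+ 2).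
Proof. by case: z. Qed.

Lemma normc_ge0 z : 0 <= Normc.normc z.
Proof. by rewrite normcE sqrtr_ge0. Qed.

Lemma normr_Re_le_normc z : `|complex.Re z| <= Normc.normc z.
Proof. by rewrite normcE -sqrtr_sqr ler_wsqrtr// lerDl sqr_ge0. Qed.

Lemma normr_Im_le_normc z : `|complex.Im z| <= Normc.normc z.
Proof. by rewrite normcE -sqrtr_sqr ler_wsqrtr// lerDr sqr_ge0. Qed.

Lemma normc_le_ReIm z :
  Normc.normc z <= `|complex.Re z| + `|complex.Im z|.
Proof.
rewrite normcE -(ger0_norm (addr_ge0 (normr_ge0 _) (normr_ge0 _))) -sqrtr_sqr.
rewrite ler_wsqrtr// sqrrD !real_normK ?num_real//.
by rewrite addrAC lerDl mulrn_wge0// mulr_ge0.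
Qed.

Lemma dot_le_normc (a b : R) z :
  a * complex.Re z + b * complex.Im z
  <= Num.sqrt (a ^+ 2 + b ^+ 2) * Normc.normc z.
Proof.
apply: le_trans (ler_norm _) _; rewrite normcE -sqrtrM ?addr_ge0 ?sqr_ge0//.
rewrite -sqrtr_sqr ler_wsqrtr//.
(* Lagrange's identity: the squares of the two sides differ by exactly this square. *)
by have := sqr_ge0 (a * complex.Im z - b * complex.Re z); lra.
Qed.

Lemma Re_Im_mulc (c z : R[i]) :
  (complex.Re (c * z) = complex.Re c * complex.Re z - complex.Im c * complex.Im z)
  /\ (complex.Im (c * z) = complex.Re c * complex.Im z + complex.Im c * complex.Re z).
Proof. by case: c z => a b [x y]. Qed.

Lemma measurable_normc d (T : measurableType d) (f : T -> R[i]) :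
  cmeasurable f -> measurable_fun setT (fun x => Normc.normc (f x)).
Proof.
move=> [mr mi]; under eq_fun do rewrite normcE.
apply: (@measurableT_comp _ _ _ _ _ _ (@Num.sqrt R)).
  apply: continuous_measurable_fun; exact: sqrt_continuous.
by apply: measurable_funD; exact: measurable_funX.
Qed.

Lemma cmeasurableB d (T : measurableType d) (f g : T -> R[i]) :
  cmeasurable f -> cmeasurable g -> cmeasurable (fun x => f x - g x).
Proof.
move=> [fr fi] [gr gi]; split.
- under eq_fun do rewrite raddfB.
  exact: measurable_funB.
- under eq_fun do rewrite raddfB.
  exact: measurable_funB.
Qed.

End ComplexModulus.

(** * Null sets of a product measure and restricted measures *)

Section AlmostEverywhereSections.
Context {R : realType} {d d' : measure_display}.
Context {Y : measurableType d} {W : measurableType d'}.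
Variables (mu : {sigma_finite_measure set Y -> \bar R})
  (P : {sigma_finite_measure set W -> \bar R}).

(** The measure of a null set of the product is the integral of the measures of its sections; a
    nonnegative function with integral 0 vanishes almost everywhere. *)
Lemma ae_xsection (Q : Y * W -> Prop) :
  (\forall z \ae (mu \x P)%E, Q z) ->
  \forall y \ae mu, \forall w \ae P, Q (y, w).
Proof.
move=> [N [mN N0 QN]].
have mfN := measurable_fun_xsection P mN.
have : (\int[mu]_y `|(P \o xsection N) y| = 0)%E.
  by rewrite -N0; apply: eq_integral => y _; rewrite gee0_abs.
move=> /(ae_eq_integral_abs mu measurableT mfN).
apply: filterS => y /(_ I) /= Ny0.
exists (xsection N y); split => //; first exact: measurable_xsection.
by move=> w nQ; rewrite /xsection /= inE; exact: QN.
Qed.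

End AlmostEverywhereSections.

Lemma integral_mrestr (R : realType) d (T : measurableType d)
    (m : {measure set T -> \bar R}) (D : set T) (mD : measurable D) (f : T -> \bar R) :
  measurable_fun setT f -> (forall z, 0 <= f z)%E ->
  (\int[mrestr m mD]_z f z = \int[m]_(z in D) f z)%E.
Proof.
move=> mf f0.
have D0 : mrestr m mD (~` D) = 0%E by rewrite /mrestr setICl measure0.
rewrite (@ge0_negligible_integral _ _ _ (mrestr m mD) setT (~` D) f)//; last first.
  exact: measurableC.
rewrite setTD setCK.
by apply: eq_measure_integral => A mA AD; rewrite [LHS]/(m (A `&` D)) setIidl.
Qed.

(** * The averaging operator and its [L^1] and [L^oo] bounds *)

Section Transport.
Context {R : realType} {dX dY dW : measure_display}.
Context {X : measurableType dX} {Y : measurableType dY} {W : measurableType dW}.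
Variables (alpha : {measure set X -> \bar R})
  (mu : {sigma_finite_measure set Y -> \bar R})
  (P : {sigma_finite_measure set W -> \bar R}).
Variables (E : set (Y * W)) (tau : Y * W -> X).

Definition pull (k : X -> R) (z : Y * W) : R := \1_E z * k (tau z).

(** [Rintegral] returns a real number even when a section is not integrable, so the algebraic
    properties of this operator hold only at those [y] whose sections are integrable, which is
    almost all of them on [L^1 + L^oo]. *)
Definition transport (f : X -> R[i]) (y : Y) : R[i] :=
  (Rintegral P setT (fun w => pull (fun x => complex.Re (f x)) (y, w)) +i*
   Rintegral P setT (fun w => pull (fun x => complex.Im (f x)) (y, w)))%C.

Hypotheses (mE : measurable E) (mtau : measurable_fun setT tau).
(** Domination of the image measure gives the [L^1] bound and the passage to classes; the bound
    [E_le1] on the sections gives the [L^oo] bound. *)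
Hypothesis domE : forall A, measurable A ->
  ((mu \x P) (E `&` tau @^-1` A) <= alpha A)%E.
Hypothesis E_le1 : forall y, (P (xsection E y) <= 1)%E.

Lemma measurable_pull k : measurable_fun setT k -> measurable_fun setT (pull k).
Proof.
by move=> mk; apply: measurable_funM;
  [exact: measurable_indic | exact: measurableT_comp].
Qed.

Lemma measurable_pull_section k y : measurable_fun setT k ->
  measurable_fun setT (fun w => pull k (y, w)).
Proof.
by move=> mk; apply: (@measurable_fun_pair2 _ _ _ _ _ _ (pull k)); exact: measurable_pull.
Qed.

Lemma pull_ge0 k z : (forall x, 0 <= k x) -> 0 <= pull k z.
Proof. by move=> k0; rewrite mulr_ge0. Qed.

Lemma normr_pull k z : `|pull k z| = pull (fun x => `|k x|) z.
Proof. by rewrite /pull normrM ger0_norm. Qed.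

(** An integral is by definition the difference of the integrals of the positive and negative parts,
    and Tonelli makes each of these measurable in [y], whether or not they are finite. *)
Lemma measurable_avg k : measurable_fun setT k ->
  measurable_fun setT (fun y => Rintegral P setT (fun w => pull k (y, w))).
Proof.
move=> mk; apply: measurableT_comp; first exact: fine_measurable.
have mpE : measurable_fun setT (EFin \o pull k).
  by apply/measurable_EFinP; exact: measurable_pull.
have -> : (fun y => \int[P]_w (pull k (y, w))%:E)%E =
  (fubini_F P ((EFin \o pull k)^\+)%E \- fubini_F P ((EFin \o pull k)^\-))%E.
  apply/funext => y; rewrite [LHS]integralE /fubini_F /=.
  by congr (_ - _)%E; apply: eq_integral => w _; rewrite ?funeposE ?funenegE.
by apply: emeasurable_funB; apply: measurable_fun_fubini_tonelli_F => //;
  [exact: measurable_funepos | exact: measurable_funeneg].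
Qed.

Lemma ae_pull (Q : X -> Prop) : (\forall x \ae alpha, Q x) ->
  \forall y \ae mu, \forall w \ae P, E (y, w) -> Q (tau (y, w)).
Proof.
move=> [N [mN N0 QN]].
apply: (@ae_xsection _ _ _ _ _ mu P (fun z => E z -> Q (tau z))).
have mEN : measurable (E `&` tau @^-1` N).
  by apply: measurableI => //; rewrite -[_ @^-1` _]setTI; exact: mtau.
exists (E `&` tau @^-1` N); split => //.
  by apply/eqP; rewrite -measure_le0/= -N0 domE.
by move=> z /not_implyP[Ez nQ]; split => //; exact: QN.
Qed.

(** Tonelli gives an integral over [E], the image measure under [tau] moves it to [X], and [domE]
    compares that measure with [alpha]. This is the [L^1] estimate for nonnegative functions. *)
Lemma integral_pull_le (k : X -> R) : measurable_fun setT k -> (forall x, 0 <= k x) ->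
  (\int[mu]_y \int[P]_w (pull k (y, w))%:E <= \int[alpha]_x (k x)%:E)%E.
Proof.
move=> mk k0.
have mpE : measurable_fun setT (EFin \o pull k).
  by apply/measurable_EFinP; exact: measurable_pull.
rewrite -[leLHS](@fubini_tonelli1 _ _ _ _ _ mu P (EFin \o pull k))//; last first.
  by move=> z; rewrite lee_fin pull_ge0.
have -> : (\int[(mu \x P)%E]_z (EFin \o pull k) z =
    \int[(mu \x P)%E]_(z in E) ((EFin \o k) \o tau) z)%E.
  rewrite [RHS]integral_mkcond; apply: eq_integral => z _.
  rewrite /= /pull indicE patchE; case: ifPn => zE; first by rewrite mul1r.
  by rewrite mul0r.
rewrite -(integral_mrestr (mu \x P)%E mE); last 2 first.
- by apply: measurableT_comp => //; exact/measurable_EFinP.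
- by move=> z; rewrite lee_fin.
have mkE : measurable_fun setT (EFin \o k) by apply/measurable_EFinP.
have := @ge0_integral_pushforward _ _ _ _ _ tau mtau (mrestr (mu \x P)%E mE)
  setT (EFin \o k) measurableT mkE.
rewrite preimage_setT => <- //; last by move=> x _; rewrite lee_fin.
apply: ge0_le_measure_integral => //.
by move=> A /domE; rewrite setIC.
Qed.

Definition pull_integrable (k : X -> R) : Prop :=
  \forall y \ae mu, P.-integrable setT (fun w => (pull k (y, w))%:E).

Lemma pull_integrableD k1 k2 : pull_integrable k1 -> pull_integrable k2 ->
  pull_integrable (fun x => k1 x + k2 x).
Proof.
apply: filterS2 => y i1 i2; have := integrableD measurableT i1 i2.
apply: eq_integrable => // w _.
by rewrite /pull mulrDr EFinD.
Qed.

Lemma pull_integrable1 (k : X -> R) : measurable_fun setT k ->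
  (\int[alpha]_x `|k x|%:E < +oo)%E -> pull_integrable k.
Proof.
move=> mk ki; apply: (@ae_integrable1 _ _ _ _ _ mu P (EFin \o pull k)).
have mpE : measurable_fun setT (EFin \o pull k).
  by apply/measurable_EFinP; exact: measurable_pull.
apply/integrable12ltyP => //; apply: le_lt_trans ki.
apply: le_trans (@integral_pull_le (fun x => `|k x|) _ _) => //; last first.
  exact: measurableT_comp.
rewrite le_eqVlt; apply/orP; left; apply/eqP.
apply: eq_integral => y _; apply: eq_integral => w _.
by rewrite /= normr_pull.
Qed.

(** For almost every [y] the bound holds at almost all points [tau (y, w)] with [(y, w)] in [E], and
    the section of [E] at [y] has mass at most one. *)
Lemma integral_pull_bounded (k : X -> R) (M : R) : 0 <= M ->
  measurable_fun setT k -> (forall x, 0 <= k x) ->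
  (\forall x \ae alpha, k x <= M) ->
  \forall y \ae mu, (\int[P]_w (pull k (y, w))%:E <= M%:E)%E.
Proof.
move=> M0 mk k0 /ae_pull; apply: filterS => y kM.
have mEy := measurable_xsection y mE.
apply: (@le_trans _ _ (\int[P]_w (M * \1_(xsection E y) w)%:E)%E).
  apply: ae_ge0_le_integral => //.
  - by move=> w _; rewrite lee_fin pull_ge0.
  - by apply/measurable_EFinP; exact: measurable_pull_section.
  - by move=> w _; rewrite lee_fin mulr_ge0.
  - by apply/measurable_EFinP/measurable_funM => //; exact: measurable_indic.
  - apply: filterS kM => w kM _; rewrite lee_fin /pull !indicE mem_xsection mulrC.
    by case: (boolP ((y, w) \in E)) => [/set_mem /kM|_]; rewrite ?mulr1 ?mulr0.
under eq_integral do rewrite EFinM.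
rewrite ge0_integralZl//; last exact/measurable_EFinP/measurable_indic.
rewrite integral_indic// setIT.
have := E_le1 y.
by move=> /(lee_wpmul2l (_ : 0 <= M%:E)%E); rewrite mule1; apply.
Qed.

Lemma pull_integrable_bounded (k : X -> R) (M : R) : 0 <= M -> measurable_fun setT k ->
  (\forall x \ae alpha, `|k x| <= M) -> pull_integrable k.
Proof.
move=> M0 mk kM.
have mnk : measurable_fun setT (fun x => `|k x|) by exact: measurableT_comp.
have := integral_pull_bounded M0 mnk (fun=> normr_ge0 _) kM.
apply: filterS => y iM; apply/integrableP; split.
  by apply/measurable_EFinP; exact: measurable_pull_section.
apply: le_lt_trans (ltry M); apply: le_trans iM.
rewrite le_eqVlt; apply/orP; left; apply/eqP.
by apply: eq_integral => w _; rewrite /= normr_pull.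
Qed.

Lemma integrable_pull_normc (f : X -> R[i]) y : cmeasurable f ->
  P.-integrable setT (fun w => (pull (fun x => complex.Re (f x)) (y, w))%:E) ->
  P.-integrable setT (fun w => (pull (fun x => complex.Im (f x)) (y, w))%:E) ->
  P.-integrable setT (fun w => (pull (fun x => Normc.normc (f x)) (y, w))%:E).
Proof.
move=> mf ir ii.
have := integrableD measurableT (integrable_abse ir) (integrable_abse ii).
apply: le_integrable => //.
  apply/measurable_EFinP/measurable_pull_section.
  exact: measurable_normc.
move=> w _; rewrite lee_fin ger0_norm; last first.
  by apply: pull_ge0 => x; exact: normc_ge0.
rewrite ger0_norm ?addr_ge0// !normr_pull /pull -mulrDr.
by rewrite ler_wpM2l// normc_le_ReIm.
Qed.

(* Testing against the direction (a, b) of the integral itself reduces the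
   modulus of the integral to the pointwise Cauchy-Schwarz inequality. *)
Lemma normc_transport_le (f : X -> R[i]) y : cmeasurable f ->
  P.-integrable setT (fun w => (pull (fun x => complex.Re (f x)) (y, w))%:E) ->
  P.-integrable setT (fun w => (pull (fun x => complex.Im (f x)) (y, w))%:E) ->
  ((Normc.normc (transport f y))%:E
    <= \int[P]_w (pull (fun x => Normc.normc (f x)) (y, w))%:E)%E.
Proof.
move=> mf ir ii; have ino := integrable_pull_normc mf ir ii.
rewrite normcE/=; set a := Rintegral _ _ _; set b := Rintegral _ _ _.
set n := Num.sqrt _.
have n0 : 0 <= n by exact: sqrtr_ge0.
rewrite -[leRHS]fineK ?integrable_fin_num// lee_fin.
rewrite -[leRHS]/(Rintegral P setT (fun w => pull (fun x => Normc.normc (f x)) (y, w))).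
have [->|nN0] := eqVneq n 0.
  by apply: Rintegral_ge0 => w _; apply: pull_ge0 => x; exact: normc_ge0.
have ngt0 : 0 < n by rewrite lt_neqAle eq_sym nN0.
rewrite -(ler_pM2l ngt0) -RintegralZl//.
have -> : n * n = a * a + b * b.
  by rewrite -!expr2 sqr_sqrtr// addr_ge0// sqr_ge0.
rewrite {2}/a {2}/b -!RintegralZl//.
have iZ c k : P.-integrable setT (fun w => (pull k (y, w))%:E) ->
    P.-integrable setT (EFin \o (fun w => c * pull k (y, w))).
  by move=> /(integrableZl measurableT c); apply: eq_integrable => // w _.
rewrite -RintegralD//; [|exact: iZ|exact: iZ].
apply: le_Rintegral => //.
- have := integrableD measurableT (iZ a _ ir) (iZ b _ ii).
  by apply: eq_integrable => // w _.
- exact: iZ.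
move=> w _; rewrite /pull !(mulrCA _ (\1_E _)) -mulrDr ler_wpM2l//.
exact: dot_le_normc.
Qed.

Lemma cmeasurable_transport f : cmeasurable f -> cmeasurable (transport f).
Proof. by move=> [mr mi]; split; exact: measurable_avg. Qed.

Lemma cLp1_integrable f : cLp alpha 1%E f ->
  pull_integrable (fun x => complex.Re (f x)) /\
  pull_integrable (fun x => complex.Im (f x)).
Proof.
move=> [mf]; rewrite /cLnorm Lnorm1 => fy.
have mn := measurable_normc mf.
have le (k : X -> R) : measurable_fun setT k -> (forall x, `|k x| <= Normc.normc (f x)) ->
    (\int[alpha]_x `|k x|%:E < +oo)%E.
  move=> mk kn; apply: le_lt_trans fy; apply: ge0_le_integral => //.
  - by apply/measurable_EFinP; exact: measurableT_comp.
  - by apply: measurableT_comp => //; exact/measurable_EFinP.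
  - by move=> x _; rewrite /= lee_fin (ger0_norm (normc_ge0 _)).
case: mf => mr mi; split; apply: pull_integrable1 => //; apply: le => // x.
- exact: normr_Re_le_normc.
- exact: normr_Im_le_normc.
Qed.

Lemma cLpoo_bounded f : cLp alpha +oo%E f ->
  exists2 M : R, 0 <= M & \forall x \ae alpha, Normc.normc (f x) <= M.
Proof.
(* The [L^oo] norm is 0 by convention when the whole space has measure 0; every bound then holds
   almost everywhere. *)
move=> [mf]; rewrite /cLnorm unlock; case: ifPn => [a0 fy|]; last first.
  rewrite -leNgt measure_le0 => /eqP a0 _; exists 0 => //; exact: measure0_ae.
have [M fM] := ess_supr_bounded (fy : ess_sup alpha (EFin \o _) < +oo)%E.
exists (Num.max M 0); first by rewrite le_max lexx orbT.
apply: filterS fM => x /=; rewrite (ger0_norm (normc_ge0 _)) => h.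
by rewrite le_max h.
Qed.

Lemma cLpoo_integrable f : cLp alpha +oo%E f ->
  pull_integrable (fun x => complex.Re (f x)) /\
  pull_integrable (fun x => complex.Im (f x)).
Proof.
move=> fL; have [M M0 fM] := cLpoo_bounded fL; case: fL => -[mr mi] _.
split; apply: (pull_integrable_bounded M0) => //; apply: filterS fM => x.
- exact/le_trans/normr_Re_le_normc.
- exact/le_trans/normr_Im_le_normc.
Qed.

Lemma cL1Loo_measurable f : cL1Loo alpha f -> cmeasurable f.
Proof.
move=> [g [h [[[gr gi] _] [[hr hi] _] ->]]]; split.
- by under eq_fun do rewrite raddfD; exact: measurable_funD.
- by under eq_fun do rewrite raddfD; exact: measurable_funD.
Qed.

Lemma cL1Loo_integrable f : cL1Loo alpha f ->
  pull_integrable (fun x => complex.Re (f x)) /\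
  pull_integrable (fun x => complex.Im (f x)).
Proof.
move=> [g [h [/cLp1_integrable[gr gi] /cLpoo_integrable[hr hi] ->]]]; split.
- by under eq_fun do rewrite raddfD; exact: pull_integrableD.
- by under eq_fun do rewrite raddfD; exact: pull_integrableD.
Qed.

Lemma cLnorm1_transport f : cLp alpha 1%E f ->
  (cLnorm mu 1%E (transport f) <= cLnorm alpha 1%E f)%E.
Proof.
move=> fL; have [ir ii] := cLp1_integrable fL; case: fL => mf _.
have mn := measurable_normc mf.
have mpE : measurable_fun setT (EFin \o pull (fun x => Normc.normc (f x))).
  by apply/measurable_EFinP; exact: measurable_pull.
have p0 z : 0 <= pull (fun x => Normc.normc (f x)) z.
  by apply: pull_ge0 => x; exact: normc_ge0.
rewrite /cLnorm !Lnorm1.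
apply: (@le_trans _ _
  (\int[mu]_y \int[P]_w (pull (fun x => Normc.normc (f x)) (y, w))%:E)%E).
  apply: ae_ge0_le_integral => //.
  - do 2 apply: measurableT_comp => //.
    exact/measurable_normc/cmeasurable_transport.
  - by move=> y _; apply: integral_ge0 => w _; rewrite lee_fin.
  - by apply: (@measurable_fun_fubini_tonelli_F _ _ _ _ _ P _ mpE) => z; rewrite lee_fin.
  - apply: filterS2 ir ii => y ir ii _.
    by rewrite /= ger0_norm ?normc_ge0//; exact: normc_transport_le.
apply: le_trans (@integral_pull_le (fun x => Normc.normc (f x)) mn _) _.
  by move=> x; exact: normc_ge0.
rewrite le_eqVlt; apply/orP; left; apply/eqP.
by apply: eq_integral => x _; rewrite /= ger0_norm ?normc_ge0.
Qed.

Lemma cLnormoo_transport f : cLp alpha +oo%E f ->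
  (cLnorm mu +oo%E (transport f) <= cLnorm alpha +oo%E f)%E.
Proof.
move=> fL; have [ir ii] := cLpoo_integrable fL.
have [M M0 fM] := cLpoo_bounded fL; case: fL => mf fy.
have mn := measurable_normc mf.
(* Any almost everywhere bound [c] will do; it is then taken to be the essential supremum itself, or
   0 when [alpha] is the zero measure. *)
suff H (c : R) : 0 <= c -> (\forall x \ae alpha, Normc.normc (f x) <= c) ->
    (cLnorm mu +oo%E (transport f) <= c%:E)%E.
  move: fy; rewrite [X in (X < _)%E -> (_ <= X)%E]/cLnorm unlock.
  case: ifPn => [a0 fy|]; last first.
    rewrite -leNgt measure_le0 => /eqP a0 _; apply: H => //.
    exact: measure0_ae.
  have e0 : (0 <= ess_sup alpha (abse \o (fun x => (Normc.normc (f x))%:E)))%E.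
    by apply: ess_sup_gee => //; apply: aeW => x; exact: abse_ge0.
  rewrite -[leRHS]fineK ?ge0_fin_numE//; apply: H; first exact: fine_ge0.
  have := ess_sup_ge alpha (abse \o (fun x => (Normc.normc (f x))%:E)).
  apply: filterS => x; rewrite -{1}[X in (_ <= X)%E]fineK ?ge0_fin_numE// lee_fin.
  by apply: le_trans; exact: ler_norm.
move=> c0 fc; rewrite /cLnorm unlock; case: ifPn => // _.
apply/ess_supP.
have := integral_pull_bounded c0 mn (fun x => normc_ge0 (f x)) fc.
apply: filterS3 ir ii => y ir ii; apply: le_trans.
by rewrite /= ger0_norm ?normc_ge0//; exact: normc_transport_le.
Qed.

(** * Compatibility with classes, linearity, positivity, and admissibility *)

Lemma transport_ae_eq f g : cmeasurable f -> cmeasurable g ->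
  f = g %[ae alpha] -> transport f = transport g %[ae mu].
Proof.
move=> [mfr mfi] [mgr mgi] /ae_pull; apply: filterS => y fg _.
have H (k1 k2 : X -> R) : measurable_fun setT k1 -> measurable_fun setT k2 ->
    (\forall w \ae P, E (y, w) -> k1 (tau (y, w)) = k2 (tau (y, w))) ->
    Rintegral P setT (fun w => pull k1 (y, w)) =
    Rintegral P setT (fun w => pull k2 (y, w)).
  move=> m1 m2 k12; congr fine; apply: ae_eq_integral => //.
  - by apply/measurable_EFinP; exact: measurable_pull_section.
  - by apply/measurable_EFinP; exact: measurable_pull_section.
  - apply: filterS k12 => w k12 _; congr EFin; rewrite /pull indicE.
    by case: (boolP ((y, w) \in E)) => [/set_mem /k12 ->|]; rewrite ?mul0r.
rewrite /transport; congr (_ +i* _)%C; apply: H => //.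
- by apply: filterS fg => w h /h ->.
- by apply: filterS fg => w h /h ->.
Qed.

Lemma transport_linear (c : R[i]) f g : cL1Loo alpha f -> cL1Loo alpha g ->
  transport (fun x => c * f x + g x) =
  (fun y => c * transport f y + transport g y) %[ae mu].
Proof.
move=> /cL1Loo_integrable[fr fi] /cL1Loo_integrable[gr gi].
have iZ a k y : P.-integrable setT (fun w => (pull k (y, w))%:E) ->
    P.-integrable setT (EFin \o (fun w => a * pull k (y, w))).
  by move=> /(integrableZl measurableT a); apply: eq_integrable => // w _.
(* One real combination serves both components of [c * f + g]: the coefficients are [Re c] and
   [- Im c] for the real part, [Re c] and [Im c] for the imaginary part. *)
have comb (a b : R) k1 k2 k3 y :
    P.-integrable setT (fun w => (pull k1 (y, w))%:E) ->
    P.-integrable setT (fun w => (pull k2 (y, w))%:E) ->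
    P.-integrable setT (fun w => (pull k3 (y, w))%:E) ->
    Rintegral P setT (fun w => pull (fun x => a * k1 x + b * k2 x + k3 x) (y, w)) =
    a * Rintegral P setT (fun w => pull k1 (y, w)) +
    b * Rintegral P setT (fun w => pull k2 (y, w)) +
    Rintegral P setT (fun w => pull k3 (y, w)).
  move=> i1 i2 i3; rewrite -!RintegralZl// -RintegralD//; [|exact: iZ|exact: iZ].
  rewrite -RintegralD//; last first.
    have := integrableD measurableT (iZ a _ _ i1) (iZ b _ _ i2).
    by apply: eq_integrable => // w _.
  by apply: eq_Rintegral => w _; rewrite /pull; ring.
apply: filterS2 (filterI fr fi) (filterI gr gi) => y [ifr ifi] [igr igi] _.
apply/eqP; rewrite eq_complex; apply/andP; split; apply/eqP; rewrite raddfD/=.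
- rewrite (Re_Im_mulc _ _).1 -mulNr -comb//; apply: eq_Rintegral => w _; rewrite /pull.
  by rewrite raddfD/= (Re_Im_mulc _ _).1 mulNr.
- rewrite (Re_Im_mulc _ _).2 -comb//; apply: eq_Rintegral => w _; rewrite /pull.
  by rewrite raddfD/= (Re_Im_mulc _ _).2.
Qed.

Lemma transport_positive : positive_map alpha mu transport.
Proof.
move=> f /cL1Loo_measurable mf f0.
(* A representative of the class of [f] that is real and nonnegative everywhere, so that positivity
   of the integrals becomes pointwise. *)
pose g x : R[i] := (`|complex.Re (f x)| +i* 0)%C.
have fg : f = g %[ae alpha].
  apply: filterS f0 => x; rewrite /g; case: (f x) => a b.
  by rewrite lecE/= => /andP[/eqP -> a0] _; rewrite ger0_norm.
have mg : cmeasurable g.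
  by split => /=; [apply: measurableT_comp => //; case: mf|exact: measurable_cst].
apply: filterS (transport_ae_eq mf mg fg) => y /(_ I) ->.
rewrite lecE/=; apply/andP; split.
  apply/eqP; rewrite /Rintegral integral0_eq// => w _.
  by rewrite /pull mulr0.
by apply: Rintegral_ge0 => w _; apply: pull_ge0.
Qed.

Lemma transport_cL1Loo f : cL1Loo alpha f -> cL1Loo mu (transport f).
Proof.
move=> fL; have mf := cL1Loo_measurable fL.
move: (fL) => [g [h [gL hL fE]]].
(* The decomposition must be an equality of functions, whereas [transport] is additive only almost
   everywhere. The first summand is therefore this difference, which equals [transport g] almost
   everywhere and so has the same [L^1] norm. *)
exists (fun y => transport f y - transport h y), (transport h); split.
- split.
    apply: cmeasurableB; apply: cmeasurable_transport => //; exact: hL.1.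
  apply: le_lt_trans (le_lt_trans (cLnorm1_transport gL) gL.2).
  rewrite /cLnorm !Lnorm1 le_eqVlt; apply/orP; left; apply/eqP.
  apply: ae_eq_integral => //.
  + do 2 apply: measurableT_comp => //; apply: measurable_normc.
    by apply: cmeasurableB; apply: cmeasurable_transport => //; exact: hL.1.
  + do 2 apply: measurableT_comp => //; apply: measurable_normc.
    by apply: cmeasurable_transport; exact: gL.1.
  + have [gr gi] := cLp1_integrable gL.
    have [hr hi] := cLpoo_integrable hL.
    apply: filterS2 (filterI gr gi) (filterI hr hi) => y [igr igi] [ihr ihi] _.
    congr (`|(Normc.normc _)%:E|)%E; apply/eqP; rewrite subr_eq; apply/eqP.
    rewrite fE /transport; apply/eqP; rewrite eq_complex/=.
    rewrite -!RintegralD//; apply/andP; split; apply/eqP;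
      apply: eq_Rintegral => w _; by rewrite /pull raddfD mulrDr.
- split; first by apply: cmeasurable_transport; exact: hL.1.
  exact: le_lt_trans (cLnormoo_transport hL) hL.2.
- by apply/funext => y; rewrite subrK.
Qed.

Lemma transport_admissible : admissible alpha mu transport.
Proof.
split.
- split; first exact: transport_cL1Loo.
    move=> f g fL gL; apply: transport_ae_eq; exact: cL1Loo_measurable.
  exact: transport_linear.
- exists 1 => f fL; rewrite mul1e; have fn := cLnorm1_transport fL.
  split => //; split; last exact: le_lt_trans fn fL.2.
  by apply: cmeasurable_transport; exact: fL.1.
- exists 1 => f fL; rewrite mul1e; have fn := cLnormoo_transport fL.
  split => //; split; last exact: le_lt_trans fn fL.2.
  by apply: cmeasurable_transport; exact: fL.1.
Qed.

Lemma transport_norm_le1 : (admissible_norm alpha mu transport <= 1)%E.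
Proof.
rewrite /admissible_norm ge_max; apply/andP; split.
- apply: ge_ereal_sup => _ [f [fL f1] <-].
  exact: le_trans (cLnorm1_transport fL) f1.
- apply: ge_ereal_sup => _ [f [fL f1] <-].
  exact: le_trans (cLnormoo_transport fL) f1.
Qed.

End Transport.

(** * The distribution of the rank *)

(** Lebesgue measure is an infimum of total lengths over countable covers by half-open intervals,
    and [nu] is countably subadditive over each such cover. *)
Lemma le_lebesgue_measure (R : realType)
    (nu : {measure set (measurableTypeR R) -> \bar R}) :
  (forall p q : R, p <= q -> (nu `]p, q]%classic <= (q - p)%:E)%E) ->
  forall A, measurable A -> (nu A <= @lebesgue_measure R A)%E.
Proof.
move=> nu_itv A mA.
rewrite [leRHS]/(ereal_inf _); apply: le_ereal_inf_tmp => _ [F [mF AF] <-].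
have mF' i : measurable (F i : set (measurableTypeR R)).
  by apply: sub_sigma_algebra; exact: mF.
have := @measure_sigma_subadditive _ _ _ nu A F mF' mA AF.
move=> /le_trans; apply.
apply: lee_nneseries => // i _; have [[p q] _ <-] := mF i.
apply: (@le_trans _ _ (wlength idfun [set` `]p, q]])); last by [].
rewrite wlength_itv /= lte_fin; case: ltP => [pq|qp].
  by apply: nu_itv; exact: ltW.
by rewrite set_itv_ge ?measure0// bnd_simp -leNgt.
Qed.

Lemma lebesgue_measure_unit_itv (R : realType) :
  @lebesgue_measure R `[0%R, 1%R[%classic = 1%E.
Proof. by rewrite [LHS]lebesgue_measure_itv/= lte_fin ltr01 oppr0 adde0. Qed.

Section RealLevelSets.
Context {R : realType} {d : measure_display} {T : measurableType d}.
Implicit Types f g : T -> R.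

Lemma measurable_ltr f g : measurable_fun setT f -> measurable_fun setT g ->
  measurable [set x | f x < g x].
Proof.
move=> mf mg; rewrite -[X in measurable X]setTI.
exact: (measurable_fun_ltr mf mg measurableT (I : measurable [set true])).
Qed.

Lemma measurable_ler f g : measurable_fun setT f -> measurable_fun setT g ->
  measurable [set x | f x <= g x].
Proof.
move=> mf mg; rewrite -[X in measurable X]setTI.
exact: (measurable_fun_ler mf mg measurableT (I : measurable [set true])).
Qed.

Lemma measurable_eqr f g : measurable_fun setT f -> measurable_fun setT g ->
  measurable [set x | f x = g x].
Proof.
move=> mf mg.
have -> : [set x | f x = g x] = [set x | f x <= g x] `&` [set x | g x <= f x].
  apply/seteqP; split => x /=; first by move=> ->; rewrite lexx.
  by move=> [h1 h2]; apply/le_anti; rewrite h1 h2.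
by apply: measurableI; exact: measurable_ler.
Qed.

End RealLevelSets.

(** * The distribution function of [r]: one-sided limits and quantiles *)

Section Distribution.
Context {R : realType} {d : measure_display} {Y : measurableType d}.
Variables (mu : {sigma_finite_measure set Y -> \bar R}) (r : Y -> R).

Definition distrib (s : R) : \bar R := mu [set y | s < r y].
Definition atom (s : R) : \bar R := mu [set y | r y = s].

Hypothesis mr : measurable_fun setT r.

Let mcst (s : R) : measurable_fun setT (fun _ : Y => s).
Proof. exact: measurable_cst. Qed.

Let mgt s : measurable [set y | s < r y].
Proof. exact: (measurable_ltr (mcst s) mr). Qed.

Let mge s : measurable [set y | s <= r y].
Proof. exact: (measurable_ler (mcst s) mr). Qed.

Let meq s : measurable [set y | r y = s].
Proof. exact: (measurable_eqr mr (mcst s)). Qed.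

(** The value at [y] is the measure of the section at [y] of the measurable set of pairs with
    [r z.1 < r z.2]. *)
Lemma measurable_distrib : measurable_fun setT (fun y => distrib (r y)).
Proof.
have mA : measurable [set z : Y * Y | r z.1 < r z.2].
  by apply: measurable_ltr; exact: measurableT_comp.
have := measurable_fun_xsection mu mA; congr (measurable_fun _ _).
apply/funext => y; congr (mu _).
by apply/seteqP; split => x /=; rewrite /xsection /= inE.
Qed.

Lemma measurable_atom : measurable_fun setT (fun y => atom (r y)).
Proof.
have mA : measurable [set z : Y * Y | r z.2 = r z.1].
  by apply: measurable_eqr; exact: measurableT_comp.
have := measurable_fun_xsection mu mA; congr (measurable_fun _ _).
apply/funext => y; congr (mu _).
by apply/seteqP; split => x /=; rewrite /xsection /= inE.
Qed.

Lemma le_distrib s t : s <= t -> (distrib t <= distrib s)%E.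
Proof.
move=> st; apply: le_measure; rewrite ?inE//.
by move=> y /=; exact: le_lt_trans.
Qed.

Lemma distribD_atom s : (distrib s + atom s = mu [set y | (s <= r y)%R])%E.
Proof.
rewrite /distrib /atom -measureU//; last first.
  by apply/seteqP; split => // y /= [+ ys]; rewrite ys ltxx.
congr (mu _); apply/seteqP; split => y /=.
  by case=> [/ltW//|->].
by rewrite le_eqVlt => /predU1P[->|]; [right|left].
Qed.

(** Right continuity of [distrib], by continuity of [mu] from below along [s + 1/(n+1)]; infinite
    values are allowed. *)
Lemma distrib_le_right s (c : \bar R) :
  (forall t, s < t -> (distrib t <= c)%E) -> (distrib s <= c)%E.
Proof.
move=> H; pose F n := [set y | s + n.+1%:R^-1 < r y].
have UF : \bigcup_n F n = [set y | s < r y].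
  apply/seteqP; split => y /=.
    by move=> [n _]; apply: le_lt_trans; rewrite lerDl invr_ge0.
  rewrite -subr_gt0 => h; have [k kh] := ltr_add_invr h.
  by exists k => //; rewrite /F /= -ltrBrDl -[X in X < _]add0r.
have cF : (mu \o F) n @[n --> \oo] --> distrib s.
  rewrite /distrib -UF; apply: nondecreasing_cvg_mu => //.
  - by move=> n; exact: mgt.
  - by rewrite UF.
  - move=> n m nm; rewrite subsetEset => y; apply: le_lt_trans.
    by rewrite lerD2l lef_pV2 ?posrE// ler_nat ltnS.
rewrite -(cvg_lim _ cF)//; apply: lime_le; first by apply/cvg_ex; exists (distrib s).
by apply: nearW => n; apply: H; rewrite ltrDl invr_gt0.
Qed.

Hypothesis distrib_lty : forall s : R, 0 < s -> (distrib s < +oo)%E.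

(** The left limit of [distrib] at [s] is [distrib s + atom s], by continuity from above. *)
Lemma distrib_le_left (s : R) (c : \bar R) : 0 < s ->
  (forall t : R, 0 < t < s -> (c <= distrib t)%E) -> (c <= distrib s + atom s)%E.
Proof.
move=> s0 H; rewrite distribD_atom.
(* With [n.+2] all thresholds, including the first, are positive, so the decreasing sets have finite
   measure. *)
pose F n := [set y | s - s / n.+2%:R < r y].
have sn n : 0 < s - s / n.+2%:R < s.
  have n2 : 0 < n.+2%:R :> R by [].
  rewrite subr_gt0 ltr_pdivrMr// ltr_pMr// ltr1n /=.
  by rewrite ltrBlDr ltrDl divr_gt0.
have IF : \bigcap_n F n = [set y | s <= r y].
  apply/seteqP; split => y /=.
    move=> h; rewrite leNgt; apply/negP => rs.
    have e0 : 0 < (s - r y) / s by rewrite divr_gt0// subr_gt0.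
    have [k kh] := ltr_add_invr e0.
    have := h k.+1 I; rewrite /F /= => hk.
    rewrite add0r ltr_pdivlMr// in kh.
    have : s / k.+3%:R <= s * k.+1%:R^-1.
      by rewrite ler_pM2l// lef_pV2 ?posrE// ler_nat !ltnS leqW.
    rewrite mulrC in kh => /le_lt_trans /(_ kh).
    by rewrite ltNge => /negP; apply; rewrite lerBlDl -lerBlDr ltW.
  move=> sr n _; rewrite /F /=; apply: lt_le_trans sr.
  by have /andP[] := sn n.
have cF : (mu \o F) n @[n --> \oo] --> mu [set y | s <= r y].
  rewrite -IF; apply: nonincreasing_cvg_mu => //.
  - by have /andP[h _] := sn 0%N; exact: distrib_lty.
  - by move=> n; exact: mgt.
  - by rewrite IF.
  - move=> n m nm; rewrite subsetEset => y; apply: le_lt_trans.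
    by rewrite lerD2l lerN2 ler_pM2l// lef_pV2 ?posrE// ler_nat !ltnS.
rewrite -(cvg_lim _ cF)//; apply: lime_ge; first by apply/cvg_ex; eexists; exact: cF.
by apply: nearW => n; apply: H; exact: sn.
Qed.

(** Since [r] takes finite values, the sets where [r] exceeds [n+1] decrease to the empty set; the
    first has finite measure, so their measures tend to 0. *)
Lemma distrib_small (x : R) : 0 < x -> exists2 s : R, 0 < s & (distrib s <= x%:E)%E.
Proof.
move=> x0; apply: contrapT => H.
have {}H s : 0 < s -> (x%:E <= distrib s)%E.
  move=> s0; rewrite leNgt; apply/negP => /ltW h; apply: H; by exists s.
pose F n := [set y | n.+1%:R < r y].
have IF : \bigcap_n F n = set0.
  apply/seteqP; split => // y /= h.
  have := h (Num.truncn (r y)) I; rewrite /F /=.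
  by rewrite ltNge ltW// truncnS_gt.
have cF : (mu \o F) n @[n --> \oo] --> mu set0.
  rewrite -IF; apply: nonincreasing_cvg_mu => //.
  - exact: distrib_lty.
  - by move=> n; exact: mgt.
  - by rewrite IF.
  - move=> n m nm; rewrite subsetEset => y; apply: le_lt_trans.
    by rewrite ler_nat ltnS.
have : (x%:E <= limn (mu \o F))%E.
  apply: lime_ge; first by apply/cvg_ex; eexists; exact: cF.
  by apply: nearW => n; apply: H.
by rewrite (cvg_lim _ cF)// measure0 leNgt lte_fin x0.
Qed.

(** The quantile at [x] is the infimum of the levels [s] with [distrib s <= x]. Right continuity
    shows that the infimum is attained, and that it is not 0 because [x < distrib 0]. *)
Lemma distrib_level (x : R) : 0 < x -> (x%:E < distrib 0)%E ->
  exists s : R, [/\ 0 < s, (distrib s <= x%:E)%E &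
    forall t : R, 0 < t < s -> (x%:E < distrib t)%E].
Proof.
move=> x0 xm; pose A := [set s : R | 0 < s /\ (distrib s <= x%:E)%E].
have A0 : A !=set0 by have [s s0 sx] := distrib_small x0; exists s.
have lA : has_lbound A by exists 0 => s [/ltW].
have hA : has_inf A by split.
have i0 : 0 <= inf A by apply: lb_le_inf => // s [/ltW].
have ix : (distrib (inf A) <= x%:E)%E.
  apply: distrib_le_right => t it.
  have t0 : 0 < t - inf A by rewrite subr_gt0.
  have [s [s0 sx] st] := inf_adherent t0 hA.
  by apply: le_trans (le_distrib _) sx; move: st; rewrite addrC subrK => /ltW.
exists (inf A); split => //.
  rewrite lt_neqAle i0 andbT; apply/eqP => i0E.
  by move: ix; rewrite -i0E leNgt xm.
move=> t /andP[t0 ti]; rewrite ltNge; apply/negP => tx.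
have : inf A <= t by apply: inf_lbound.
by rewrite leNgt ti.
Qed.

Lemma atom_lty (s : R) : 0 < s -> (atom s < +oo)%E.
Proof.
move=> s0; have s20 : 0 < s / 2 by rewrite divr_gt0.
apply: le_lt_trans (distrib_lty s20); apply: le_measure; rewrite ?inE//.
by move=> y /= ->; rewrite ltr_pdivrMr// ltr_pMr// ltr1n.
Qed.

Lemma distrib_fineK (s : R) : 0 < s -> ((fine (distrib s))%:E = distrib s)%E.
Proof. by move=> s0; rewrite fineK// ge0_fin_numE ?distrib_lty. Qed.

Lemma atom_fineK (s : R) : 0 < s -> ((fine (atom s))%:E = atom s)%E.
Proof. by move=> s0; rewrite fineK// ge0_fin_numE ?atom_lty. Qed.

(** * The rank and the domination of its law *)

Let W := measurableTypeR R.
Let leb : {sigma_finite_measure set W -> \bar R} := @lebesgue_measure R.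

(** The strict bound [z.2 < 1] keeps the rank strictly below the left limit of [distrib] at an atom,
    as the strict inequality in the definition of [rearrangement] demands. *)
Definition spread_dom : set (Y * W) :=
  [set z | 0 < r z.1] `&` [set z | (0 : R) <= z.2] `&` [set z | z.2 < (1 : R)].

(* The rank of y for the order decreasing in r, the atoms of r being spread
   out uniformly with the help of the second coordinate. *)
Definition spread (z : Y * W) : W :=
  fine (distrib (r z.1)) + (z.2 : R) * fine (atom (r z.1)).

Let mfst (k : Y -> R) : measurable_fun setT k ->
  measurable_fun setT (fun z : Y * W => k z.1).
Proof. by move=> mk; exact: measurableT_comp. Qed.

Let msnd : measurable_fun setT (fun z : Y * W => z.2 : R).
Proof. exact: measurable_snd. Qed.

Lemma measurable_spread_dom : measurable spread_dom.
Proof.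
apply: measurableI; first apply: measurableI.
- by apply: measurable_ltr; [exact: measurable_cst|exact: mfst].
- by apply: measurable_ler => //; exact: measurable_cst.
- by apply: measurable_ltr => //; exact: measurable_cst.
Qed.

Lemma measurable_spread : measurable_fun setT spread.
Proof.
apply: measurable_funD; last apply: measurable_funM => //.
- apply: (mfst (k := fun y => fine (distrib (r y)))).
  by apply: measurableT_comp; [exact: fine_measurable|exact: measurable_distrib].
- apply: (mfst (k := fun y => fine (atom (r y)))).
  by apply: measurableT_comp; [exact: fine_measurable|exact: measurable_atom].
Qed.

Lemma spread_ge z : spread_dom z -> (distrib (r z.1) <= (spread z)%:E)%E.
Proof.
move=> [[r0 u0] _]; rewrite -distrib_fineK// lee_fin /spread lerDl.
by rewrite mulr_ge0// fine_ge0// measure_ge0.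
Qed.

Lemma spread_le z : spread_dom z ->
  ((spread z)%:E <= distrib (r z.1) + atom (r z.1))%E.
Proof.
move=> [[r0 u0] u1]; rewrite -distrib_fineK// -atom_fineK// lee_fin /spread.
by rewrite lerD2l -[leRHS]mul1r ler_wpM2r ?(ltW u1)//; exact/fine_ge0/measure_ge0.
Qed.

Lemma spread_le_distrib z t : spread_dom z -> t < r z.1 ->
  ((spread z)%:E <= distrib t)%E.
Proof.
move=> zE tr; apply: le_trans (spread_le zE) _; rewrite distribD_atom.
by apply: le_measure; rewrite ?inE// => y /=; exact: lt_le_trans.
Qed.

Let kap : {measure set (Y * W)%type -> \bar R} := (mu \x leb)%E.

Let mrect (A : set Y) : measurable A ->
  measurable (A `*` (`[0%R, 1%R[ : set W)).
Proof. by move=> mA; apply: measurableX => //; exact: measurable_itv. Qed.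

Let kap_rect (A : set Y) : measurable A ->
  kap (A `*` (`[0%R, 1%R[ : set W)) = mu A.
Proof.
move=> mA; rewrite [LHS]product_measure1E//.
by rewrite [leb _]lebesgue_measure_unit_itv mule1.
Qed.

Let msub x : measurable (spread_dom `&` [set z | spread z <= x]).
Proof.
apply: measurableI; first exact: measurable_spread_dom.
by apply: (@measurable_ler _ _ _ spread (fun=> x)) => //; exact: measurable_spread.
Qed.

(** Let [s] be the quantile at [x]. Points with [r > s] have rank at most [distrib s <= x], points
    with [r < s] have rank at least [distrib (r y) > x], and the level set [r = s] contributes just
    the fraction of its mass that completes [distrib s] to [x]. *)
Lemma spread_distribution (x : R) : 0 < x -> (x%:E < distrib 0)%E ->
  kap (spread_dom `&` [set z | spread z <= x]) = x%:E.
Proof.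
move=> x0 xm; have [s [s0 sx xs]] := distrib_level x0 xm.
have xle : (x%:E <= distrib s + atom s)%E.
  by apply: distrib_le_left => // t ts; exact/ltW/xs.
pose m := fine (distrib s); pose a := fine (atom s).
have mE : m%:E = distrib s := distrib_fineK s0.
have aE : a%:E = atom s := atom_fineK s0.
have mx : m <= x by rewrite -lee_fin mE.
have xma : x <= m + a by rewrite -lee_fin EFinD mE aE.
have a0 : 0 <= a by rewrite fine_ge0// measure_ge0.
pose I : interval R := if m + a <= x then `[0%R, 1%R[ else `[0%R, (x - m) / a].
have IP u : 0 <= u -> u < 1 -> (u \in I) = (m + u * a <= x).
  move=> u0 u1; rewrite /I; case: (leP (m + a) x) => [max|xlt].
    rewrite in_itv/= u0 u1; apply/esym/(le_trans _ max).
    by rewrite lerD2l -[leRHS]mul1r ler_wpM2r// ltW.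
  have ap : 0 < a by lra.
  by rewrite in_itv/= u0 ler_pdivlMr// lerBrDl.
have I01 u : u \in I -> 0 <= u < 1.
  rewrite /I; case: (leP (m + a) x) => [_|xlt]; rewrite in_itv//= => /andP[-> /=].
  have ap : 0 < a by lra.
  by move=> /le_lt_trans; apply; rewrite ltr_pdivrMr// mul1r ltrBlDl.
have Ia : (a%:E * leb [set` I] = (x - m)%:E)%E.
  rewrite [leb _]lebesgue_measure_itv /I; case: (leP (m + a) x) => [max|xlt] /=.
    by rewrite lte_fin ltr01 oppr0 adde0 mule1; congr EFin; lra.
  have ap : 0 < a by lra.
  rewrite lte_fin; case: ltP => [_|]; last first.
    rewrite pmulr_lle0 ?invr_gt0// => xm0.
    by rewrite mule0; congr EFin; lra.
  by rewrite oppr0 adde0 -EFinM mulrC divfK// gt_eqF.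
have -> : spread_dom `&` [set z | spread z <= x] =
   ([set y | s < r y] `*` `[0%R, 1%R[) `|` ([set y | r y = s] `*` [set` I]).
  apply/seteqP; split => [[y u]|[y u]].
    move=> [zE zx]; have := zE => -[[/= r0 u0] u1].
    have [sr|rs|rs] := ltgtP s (r y).
    - by left; split => //=; rewrite in_itv/= u0.
    - have := xs (r y); rewrite r0 rs => /(_ isT); rewrite ltNge.
      by rewrite (le_trans (spread_ge zE)).
    - by right; split => //=; rewrite IP// /m /a rs.
  move=> [[/= sr]|[/= rs uI]].
    rewrite in_itv/= => /andP[u0 u1].
    have zE : spread_dom (y, u) by do !split => //=; exact: lt_trans sr.
    by split => //=; rewrite -lee_fin (le_trans (spread_le_distrib zE sr)).
  have /andP[u0 u1] := I01 _ uI.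
  split; first by do !split => //=; rewrite rs.
  by rewrite /= /spread /= rs -/m -/a -IP.
have mI : measurable ([set` I] : set W) by exact: measurable_itv.
have kapU (A A' : set (Y * W)) : measurable A -> measurable A' ->
  A `&` A' = set0 -> kap (A `|` A') = (kap A + kap A')%E by exact: measureU.
rewrite kapU; last 3 first.
- exact: mrect.
- exact: measurableX.
- apply/seteqP; split => // -[y u] /= [[sr _] [rs _]].
  by move: sr; rewrite rs ltxx.
rewrite kap_rect// [kap _]product_measure1E//.
transitivity (distrib s + atom s * leb [set` I])%E; first by [].
by rewrite -mE -aE Ia -EFinD addrC subrK.
Qed.

(** Beyond [distrib 0] the bound is the total mass of [spread_dom]. For [x <= 0] the mass is at most
    that of ranks below every [e > 0], hence 0. *)
Lemma spread_distribution_le (x : R) :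
  (kap (spread_dom `&` [set z | (spread z <= x)%R]) <= (Num.max x 0)%:E)%E.
Proof.
have pos (t : R) : 0 < t -> (kap (spread_dom `&` [set z | (spread z <= t)%R]) <= t%:E)%E.
  move=> t0; case: (ltP t%:E (distrib 0)) => [tm|mt].
    by rewrite spread_distribution.
  apply: le_trans mt; rewrite /distrib -kap_rect//; apply: le_measure; rewrite ?inE//.
  - exact: mrect.
  - by move=> [y u] [[[/= r0 u0] u1] _]; split => //=; rewrite in_itv/= u0.
have mono (s t : R) : s <= t -> (kap (spread_dom `&` [set z | (spread z <= s)%R]) <=
    kap (spread_dom `&` [set z | (spread z <= t)%R]))%E.
  move=> st; apply: le_measure; rewrite ?inE//.
  by move=> z [zE zs]; split => //=; exact: le_trans st.
case: (ltP 0 x) => [x0|x0]; first exact: pos.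
apply/lee_addgt0Pr => e e0; rewrite add0e.
by apply: le_trans (mono _ _ (le_trans x0 (ltW e0))) (pos _ e0).
Qed.

Definition spread_law : set W -> \bar R :=
  pushforward (mrestr kap measurable_spread_dom) spread.

Let mspread := measurable_spread.
HB.instance Definition _ := Measure.copy spread_law
  (measure_function_pushforward__canonical__measure_function_Measure
    (mrestr kap measurable_spread_dom) mspread).

Let spread_lawE A : spread_law A = kap (spread_dom `&` spread @^-1` A).
Proof. by rewrite setIC. Qed.

(** For [0 < p < distrib 0] the exact mass up to [p] is subtracted from the bound up to [q]. For
    [p <= 0] the bound up to [q] is enough, and for [p >= distrib 0] no rank exceeds [p]. *)
Lemma spread_law_itv (p q : R) : p <= q ->
  (spread_law `]p, q] <= (q - p)%:E)%E.
Proof.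
move=> pq; rewrite spread_lawE.
have mpq : measurable (spread_dom `&` spread @^-1` `]p, q]).
  apply: measurableI; first exact: measurable_spread_dom.
  by rewrite -[X in measurable X]setTI; apply: mspread => //; exact: measurable_itv.
have sub : spread_dom `&` spread @^-1` `]p, q] `<=`
    spread_dom `&` [set z | spread z <= q].
  by move=> z [zE] /=; rewrite in_itv/= => /andP[_ zq]; split.
case: (leP p 0) => [p0|p0].
  apply: (@le_trans _ _ (kap (spread_dom `&` [set z | (spread z <= q)%R]))).
    by apply: le_measure; rewrite ?inE//; exact: msub.
  apply: le_trans (spread_distribution_le q) _; rewrite lee_fin ge_max.
  by apply/andP; split; lra.
case: (ltP p%:E (distrib 0)) => [pm|mp]; last first.
  have -> : spread_dom `&` spread @^-1` `]p, q] = set0.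
    apply/seteqP; split => // z [zE] /=; rewrite in_itv/= => /andP[pz _].
    have r0 : 0 < r z.1 by case: zE => -[].
    have := le_trans (spread_le_distrib zE r0) mp.
    by rewrite lee_fin leNgt pz.
  by rewrite measure0 lee_fin subr_ge0.
have := spread_distribution_le q.
have -> : spread_dom `&` [set z | spread z <= q] =
    (spread_dom `&` [set z | spread z <= p]) `|` (spread_dom `&` spread @^-1` `]p, q]).
  apply/seteqP; split => z /=.
    move=> [zE zq]; case: (leP (spread z) p) => zp; [left|right] => //.
    by split => //; rewrite in_itv/= zp.
  move=> [[zE zp]|[zE]]; first by split => //; exact: le_trans pq.
  by rewrite in_itv/= => /andP[].
have kapU (A A' : set (Y * W)) : measurable A -> measurable A' ->
  A `&` A' = set0 -> kap (A `|` A') = (kap A + kap A')%E by exact: measureU.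
rewrite kapU//; last first.
  apply/seteqP; split => // z [[_ /= zp] [_ /=]]; rewrite in_itv/= => /andP[+ _].
  by rewrite ltNge zp.
rewrite (spread_distribution p0 pm) max_l; last by rewrite (le_trans (ltW p0)).
by rewrite -leeBrDl// EFinB.
Qed.

(** [lebesgue_pos] ignores the nonpositive half line, so the comparison with Lebesgue measure is
    made on the positive part of [A]; the remaining part is null because ranks at most 0 have mass
    0. *)
Lemma spread_law_le A : measurable A ->
  (kap (spread_dom `&` spread @^-1` A) <= lebesgue_pos A)%E.
Proof.
move=> mA; rewrite -spread_lawE.
have mpos : measurable (`]0%R, +oo[ : set W) by exact: measurable_itv.
apply: (@le_trans _ _ (spread_law (A `&` `]0%R, +oo[))); last first.
  by apply: le_lebesgue_measure; [exact: spread_law_itv|exact: measurableI].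
have neg0 : (spread_law `]-oo, 0%R] <= 0)%E.
  rewrite spread_lawE.
  have := spread_distribution_le 0; rewrite maxxx.
  by congr (kap (_ `&` _) <= _)%E.
rewrite -{1}(setIT A) (_ : setT = `]-oo, 0%R] `|` `]0%R, +oo[); last first.
  apply/seteqP; split => // x _ /=; rewrite !in_itv/= andbT.
  by case: (leP x 0) => h; [left|right].
rewrite setIUr; apply: le_trans (measureU2 _ _ _) _ => //.
- by apply: measurableI => //; exact: measurable_itv.
- exact: measurableI.
rewrite -[leRHS]add0e leeD2r//; apply: le_trans neg0; apply: le_measure; rewrite ?inE.
- by apply: measurableI => //; exact: measurable_itv.
- exact: measurable_itv.
- by move=> ? [].
Qed.

(* Where r has no atom the rank of y is m(r y); a coincidence m(r y) = m(q)
   puts the rank at a single point, hence happens almost never. *)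
Lemma ae_distrib_neq (q : R) : \forall y \ae mu, 0 < r y ->
  atom (r y) = 0%E -> fine (distrib (r y)) <> fine (distrib q).
Proof.
pose Z := [set y | 0 < r y] `&` [set y | fine (atom (r y)) = 0] `&`
  [set y | fine (distrib (r y)) = fine (distrib q)].
have mZ : measurable Z.
  apply: measurableI; first apply: measurableI => //.
  - apply: measurable_eqr => //.
    by apply: measurableT_comp; [exact: fine_measurable|exact: measurable_atom].
  - apply: measurable_eqr => //.
    by apply: measurableT_comp; [exact: fine_measurable|exact: measurable_distrib].
exists Z; split => //; last first.
  move=> y /= /not_implyP[r0 /not_implyP[a0 /contrapT dq]].
  by split => //; split => //=; rewrite a0.
apply/eqP; rewrite -measure_le0.
apply: (@le_trans _ _ (kap (Z `*` (`[0%R, 1%R[ : set W)))); first by rewrite kap_rect.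
apply: (@le_trans _ _ (kap (spread_dom `&` spread @^-1` [set fine (distrib q)]))).
  apply: le_measure; rewrite ?inE; [exact: mrect| |].
    apply: measurableI; first exact: measurable_spread_dom.
    by rewrite -[X in measurable X]setTI; apply: mspread => //; exact: measurable_set1.
  move=> [y u] [[[/= r0 a0] dq]]; rewrite in_itv/= => /andP[u0 u1].
  by split; [do !split|rewrite /= /spread /= a0 mulr0 addr0].
apply: le_trans (spread_law_le (measurable_set1 _)) _.
rewrite /lebesgue_pos/= /mrestr -(@lebesgue_measure_set1 R (fine (distrib q))).
apply: le_measure; rewrite ?inE; [|exact: measurable_set1|by move=> ? []].
by apply: measurableI; [exact: measurable_set1|exact: measurable_itv].
Qed.

(** * The rearrangement evaluated at the rank *)

Hypothesis r_ge0 : forall y, 0 <= r y.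

(** A level [t > r y] has [distrib t] at most the rank, so it does not enter the supremum.
    Conversely a rational [t < r y] enters as soon as the rank is strictly below [distrib t]: at an
    atom this follows from [u < 1], elsewhere the rank is [distrib (r y)] and equality is excluded
    by [ae_distrib_neq]. The exceptional set does not depend on [u]. *)
Lemma rearrangement_spread : \forall y \ae mu, forall u, spread_dom (y, u) ->
  rearrangement mu (EFin \o r) (spread (y, u)) = (r y)%:E.
Proof.
(* An enumeration of the rationals; the default 0 at indices that decode to nothing is harmless,
   since only positive levels are used below. *)
pose Q n : R := if unpickle n is Some q then ratr q else 0.
have := ae_foralln (fun n => ae_distrib_neq (Q n)).
apply: filterS => y neq u yuE.
have r0 : 0 < r y by case: yuE => -[].
have dE t : mu [set y | (t%:E < `|(EFin \o r) y|)%E] = distrib t.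
  by congr (mu _); apply/seteqP; split => x /=; rewrite lte_fin ger0_norm.
have lt_distrib n : 0 < Q n -> Q n < r y -> ((spread (y, u))%:E < distrib (Q n))%E.
  move=> q0 qr; have [a0|aN0] := eqVneq (atom (r y)) 0%E.
    have := neq n r0 a0; rewrite /spread /= a0 mulr0 addr0 -(distrib_fineK q0) => dN.
    rewrite lte_fin lt_neqAle; apply/andP; split; first exact/eqP.
    by rewrite -lee_fin !distrib_fineK// le_distrib// ltW.
  apply: (@lt_le_trans _ _ (distrib (r y) + atom (r y))%E); last first.
    rewrite distribD_atom; apply: le_measure; rewrite ?inE// => x /=.
    exact: lt_le_trans.
  have ap : 0 < fine (atom (r y)).
    by rewrite -lte_fin atom_fineK// lt_neqAle eq_sym aN0 measure_ge0.
  rewrite -distrib_fineK// -atom_fineK// lte_fin /spread/= ltrD2l.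
  by rewrite -[ltRHS]mul1r ltr_pM2r//; case: yuE.
apply/le_anti/andP; split.
  apply: ge_ereal_sup => _ [->|[t [t0 +] <-]]; first by rewrite lee_fin.
  move=> xt; rewrite lee_fin leNgt; apply/negP => rt.
  have {}xt : ((spread (y, u))%:E < distrib t)%E by rewrite -dE; exact: xt.
  have := lt_le_trans xt (le_distrib (ltW rt)).
  by rewrite ltNge (spread_ge yuE).
rewrite leNgt; apply/negP => sup_lt.
have sup_ge0 : (0 <= rearrangement mu (EFin \o r) (spread (y, u)))%E.
  by apply: ereal_sup_ubound; left.
have sup_fin : rearrangement mu (EFin \o r) (spread (y, u)) \is a fin_num.
  by rewrite ge0_fin_numE// (lt_trans sup_lt)// ltry.
move: sup_lt; rewrite -(fineK sup_fin) lte_fin => /rat_in_itvoo[q].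
rewrite in_itv/= => /andP[qs qr].
have Qq : Q (pickle q) = ratr q by rewrite /Q pickleK.
have q0 : 0 < ratr q :> R by apply: le_lt_trans qs; exact: fine_ge0.
move: qs; rewrite -lte_fin fineK// ltNge => /negP; apply.
apply: ereal_sup_ubound; right; exists (ratr q) => //; split => //.
have := lt_distrib (pickle q); rewrite Qq -dE => /(_ q0 qr); exact.
Qed.

End Distribution.

(** If [r > s] on a set of infinite measure, then [s] belongs to the set defining [b t] for every
    [t], so [b] stays at least [s] and cannot tend to 0. *)
Lemma distrib_core_lty (R : realType) (d : measure_display)
    (Y : measurableType d) (mu : {sigma_finite_measure set Y -> \bar R})
    (r : Y -> R) (b : R -> \bar R) :
  (forall y, 0 <= r y) -> b = rearrangement mu (EFin \o r) ->
  b t @[t --> +oo%R] --> 0%E ->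
  forall s : R, 0 < s -> (distrib mu r s < +oo)%E.
Proof.
move=> r0 bE b0 s s0; rewrite ltey; apply/negP => /eqP sy.
have : \forall t \near +oo%R, (b t < s%:E)%E.
  apply: (b0 [set x | (x < s%:E)%E]); apply: open_nbhs_nbhs; split.
    exact: open_ereal_lt_ereal.
  by rewrite /= lte_fin.
move=> [M [_ /(_ (M + 1))]]; rewrite ltrDl ltr01 => /(_ isT).
rewrite bE ltNge => /negP; apply; apply: ereal_sup_ubound; right.
exists s => //; split => //.
have dE : mu [set y | (s%:E < `|(EFin \o r) y|)%E] = distrib mu r s.
  by congr (mu _); apply/seteqP; split => x /=; rewrite lte_fin ger0_norm.
suff : ((M + 1)%:E < mu [set y | (s%:E < `|(EFin \o r) y|)%E])%E by [].
by rewrite dE sy ltry.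
Qed.

(** The section of [spread_dom] at [y] is [[0, 1[], of length one, or empty, so averaging a constant
    returns either that constant or 0. *)
Lemma transport_cst (R : realType) (d : measure_display) (Y : measurableType d)
    (mu : {sigma_finite_measure set Y -> \bar R}) (r : Y -> R)
    (f : R -> R[i]) (c : R[i]) y :
  (forall u, spread_dom r (y, u) -> f (spread mu r (y, u)) = c) ->
  transport (@lebesgue_measure R) (spread_dom r) (spread mu r) f y =
  if 0 < r y then c else 0.
Proof.
move=> fc.
have domE u : ((y, u) \in spread_dom r) = (0 < r y) && (u \in `[0%R, 1%R[).
  apply/idP/idP => [/set_mem [[/= -> u0] u1]|/andP[r0]].
    by rewrite in_itv/= u0 u1.
  by rewrite in_itv/= => /andP[u0 u1]; apply/mem_set; do !split.
have H (p : R[i] -> R) : p 0 = 0 ->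
    Rintegral (@lebesgue_measure R) setT
      (fun w => pull (spread_dom r) (spread mu r) (fun x => p (f x)) (y, w)) =
    p (if 0 < r y then c else 0).
  move=> p0; case: ifPn => ry.
    transitivity (Rintegral (@lebesgue_measure R) `[0%R, 1%R[ (fun=> p c)).
      rewrite [RHS]Rintegral_mkcond; apply: eq_Rintegral => u _.
      rewrite /pull indicE patchE domE ry/= mem_setE.
      case: ifPn => uI; last by rewrite mul0r.
      by rewrite mul1r fc//; apply/set_mem; rewrite domE ry.
    rewrite Rintegral_cst; last exact: measurable_itv.
    by rewrite [X in fine X]lebesgue_measure_unit_itv mulr1.
  rewrite p0 /Rintegral integral0_eq// => u _.
  by rewrite /pull indicE domE (negbTE ry) mul0r.
rewrite /transport !H//; by case: ifP => // _; case: (c).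
Qed.

Theorem theorem5p5 (R : realType) (dS dY : measure_display)
    (S : measurableType dS) (Y : measurableType dY)
    (lambda : {sigma_finite_measure set S -> \bar R})
    (mu : {sigma_finite_measure set Y -> \bar R})
    (B : Y -> set S) (hB : core_map lambda B)
    (b : R -> \bar R)
    (hb : b = rearrangement mu (fun y => lambda (B y)))
    (hb0 : b t @[t --> +oo%R] --> 0%E) :
  exists Phi : (R -> R[i]) -> (Y -> R[i]),
    [/\ positive_map lebesgue_pos mu Phi,
        admissible lebesgue_pos mu Phi,
        (admissible_norm lebesgue_pos mu Phi <= 1)%E
      & forall f : R -> R[i], cL1Loo lebesgue_pos f ->
          hardy_core lambda B f = Phi (hardy_b b f) %[ae mu]].
Proof.
case: hB => mB [_ mlB _ lBy].
pose r y := fine (lambda (B y)).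
have rE y : lambda (B y) = (r y)%:E by rewrite fineK// ge0_fin_numE ?lBy.
have r_ge0 y : 0 <= r y by rewrite fine_ge0.
have mr : measurable_fun setT r.
  apply: measurableT_comp; first exact: fine_measurable.
  have := mlB setT measurableT; congr (measurable_fun _ _).
  by apply/funext => y; rewrite setTI.
have bE : b = rearrangement mu (EFin \o r).
  by rewrite hb; congr (rearrangement mu _); apply/funext => y; rewrite rE.
have dlty := distrib_core_lty r_ge0 bE hb0.
have mE := measurable_spread_dom mr.
have msp := measurable_spread mu mr.
have dom := @spread_law_le _ _ _ mu r mr dlty.
have dom1 y : (@lebesgue_measure R (xsection (spread_dom r) y) <= 1)%E.
  rewrite -(lebesgue_measure_unit_itv R).
  apply: le_measure; rewrite ?inE.
  - exact: measurable_xsection.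
  - exact: measurable_itv.
  - move=> u; rewrite /xsection/= inE => -[[/= _ u0] u1].
    by rewrite in_itv/= u0.
exists (transport (@lebesgue_measure R) (spread_dom r) (spread mu r)); split.
- exact: transport_positive.
- exact: transport_admissible.
- exact: transport_norm_le1.
move=> f _; have := rearrangement_spread mr dlty r_ge0.
apply: filterS => y yE _.
(* As a function of [u] the integrand is constant: [hardy_b b f] depends on its argument only
   through [b], whose value at every rank of [y] is [r y]. *)
rewrite (@transport_cst _ _ _ _ _ (hardy_b b f) (hardy_core lambda B f y)); last first.
  move=> u uE; rewrite /hardy_b /hardy_core; congr (cintegral0 _ f).
  by rewrite bE yE// -(rE y).
(* There remain the points with [r y = 0], where the transported function is 0 and the Hardy
   integral runs over an empty set. *)
case: ltP => // ry0; rewrite /hardy_core /cintegral0.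
have -> : [set t : R | 0 < t /\ (t%:E < lambda (B y))%E] = set0.
  apply/seteqP; split => // t [t0]; rewrite [X in (_ < X)%E](rE y) lte_fin => tr.
  by have := lt_trans t0 (lt_le_trans tr ry0); rewrite ltxx.
by rewrite !Rintegral_set0.
Qed.
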